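(* Let $N$, $k_{\mathrm{trap}}$ and $d_{\mathrm{mal}}$ be integers with $N\ge 1$, $0\le k_{\mathrm{trap}}\le N$ and $1\le d_{\mathrm{mal}}\le N$. Suppose the set of trap locations is a uniformly random subset of size $k_{\mathrm{trap}}$ of $N$ physical qubit pathways, hidden from the server, and suppose a malicious deviation affects $d_{\mathrm{mal}}$ distinct pathways among the $N$. Then the probability $P_{\mathrm{undetected}}$ that the deviation avoids all trap locations satisfies $$P_{\mathrm{undetected}}\le\left(1-\frac{k_{\mathrm{trap}}}{N}\right)^{d_{\mathrm{mal}}}\le\exp\left(-\frac{d_{\mathrm{mal}}\,k_{\mathrm{trap}}}{N}\right).$$
   Context: In the trap-based verification protocol, a client secretly designates $k_{\mathrm{trap}}$ of $N$ physical qubit pathways as traps, chosen uniformly at random. Since the server does not know the trap locations, the set of $d_{\mathrm{mal}}$ affected pathways is a fixed set, chosen independently of the trap set. The deviation avoids all trap locations when the set of affected pathways is disjoint from the set of traps. *)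

(* Defs.v *)
From HB Require Import structures.
From mathcomp Require Import all_boot all_order all_algebra.
From mathcomp Require Import all_classical all_reals all_analysis.

Set Implicit Arguments.
Unset Strict Implicit.
Unset Printing Implicit Defensive.

Import Order.TTheory GRing.Theory Num.Theory.
Local Open Scope classical_set_scope.
Local Open Scope ring_scope.

(* Pathways are the elements of 'I_N. {set 'I_N} is finite, so measurability  *)
(* of a random set and its law are both given on single values: every         *)
(* k-subset has probability 1 / 'C(N, k), and every other value has           *)
(* probability 0.                                                             *)
Definition uniform_random_subset (d : measure_display) (Omega : measurableType d)
    (R : realType) (P : probability Omega R) (N k : nat)
    (T : Omega -> {set 'I_N}) : Prop :=
  forall S : {set 'I_N},
    measurable (T @^-1` [set S]) /\
    P (T @^-1` [set S]) = (if #|S| == k then ('C(N, k)%:R)^-1 else 0)%:E.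

(* %B selects the boolean disjointness of finite sets: the same notation is    *)
(* bound to disj_set in classical_set_scope.                                  *)
Definition avoids_traps (Omega : Type) (N : nat) (T : Omega -> {set 'I_N})
    (A : {set 'I_N}) : set Omega :=
  [set w | [disjoint A & T w]%B].

(* Main.v *)
Require Import Defs.
From HB Require Import structures.
From mathcomp Require Import all_boot all_order all_algebra.
From mathcomp Require Import all_classical all_reals all_analysis.
From mathcomp Require Import zify ring.

Set Implicit Arguments.
Unset Strict Implicit.
Unset Printing Implicit Defensive.

Import Order.TTheory GRing.Theory Num.Theory.
Local Open Scope ring_scope.

(** With [d] affected pathways, the trap sets that miss them are the [k]-subsets of the other
    [N - d], so the probability is exactly C(N-d, k) / C(N, k) ([probability_avoids_traps]). This
    ratio is the product over i < d of (N-i-k)/(N-i), read as 0 when N-d < k; each factor is at most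
    1 - k/N, which gives the first bound ([bin_avoid_leq]). The second is 1 + x <= exp x at x =
    -k/N, raised to the power [d]. *)

(* C(N-d, k) / C(N, k) <= (1 - k/N)^d, cleared of denominators. *)
Lemma bin_avoid_leq (N k d : nat) : (d <= N)%N ->
  ('C(N - d, k) * N ^ d <= 'C(N, k) * (N - k) ^ d)%N.
Proof.
elim: d => [|d IHd] ltdN; first by rewrite subn0 !expn0 leqnn.
have M0 : (0 < N - d)%N by rewrite subn_gt0.
(* The extra factor N-d lets [mul_bin_down] trade C(N-d-1, k) for (N-d-k) C(N-d, k), where the
   induction hypothesis applies. *)
rewrite -(leq_pmul2l M0) subnS mulnA mul_bin_down !expnS.
(* The right side exceeds the left by k d when k < N-d; otherwise truncated subtraction makes the
   left side 0. *)
have factor_leq : ((N - d - k) * N <= (N - k) * (N - d))%N.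
  by have [?|?] := leqP (N - d) k; nia.
by have := leq_mul factor_leq (IHd (ltnW ltdN)); congr (_ <= _)%N; ring.
Qed.

Lemma card_disjoint_draws (T : finType) (A : {set T}) (k : nat) :
  #|[set S : {set T} | [disjoint A & S]%B & #|S| == k]%SET| =
  'C(#|T| - #|A|, k).
Proof.
have -> : (#|T| - #|A|)%N = #|~: A| by rewrite [RHS]cardsCs finset.setCK.
rewrite -cards_draws; apply: eq_card => S.
by rewrite !inE disjoint_sym finset.disjoints_subset.
Qed.

(** Finite additivity over the disjoint fibres of [X]: this passes from the law on single values to
    the probability of an event. *)
Lemma measure_preimage_pred (d : measure_display) (Omega : measurableType d)
    (R : realType) (mu : {measure set Omega -> \bar R}) (T : finType)
    (X : Omega -> T) (D : pred T) :
  (forall x, measurable (X @^-1` [set x])%classic) ->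
  mu (X @^-1` [set x | D x])%classic = (\sum_(x | D x) mu (X @^-1` [set x])%classic)%E.
Proof.
move=> mX.
have -> : (X @^-1` [set x | D x])%classic =
    (\bigcup_(x in [set` enum D]) (X @^-1` [set x]))%classic.
  apply/seteqP; split => [w /= Dw|w [x /= + ->]]; last by rewrite mem_enum.
  by exists (X w) => //=; rewrite mem_enum.
rewrite measure_fin_bigcup //; last by move=> x y _ _ [w [/= <- <-]].
by rewrite -fsbig_seq ?enum_uniq // big_enum.
Qed.

Lemma probability_avoids_traps (d : measure_display) (Omega : measurableType d)
    (R : realType) (P : probability Omega R) (N k : nat)
    (T : Omega -> {set 'I_N}) (A : {set 'I_N}) :
  uniform_random_subset P k T ->
  P (avoids_traps T A) = ('C(N - #|A|, k)%:R / 'C(N, k)%:R)%:E.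
Proof.
move=> unifT.
rewrite (measure_preimage_pred P (fun S : {set 'I_N} => [disjoint A & S]%B)); last first.
  by move=> S; have [] := unifT S.
rewrite (eq_bigr _ (fun S _ => (unifT S).2)).
rewrite sumEFin -big_mkcondr sumr_const /= -[X in 'C(X - _, _)]card_ord.
rewrite -card_disjoint_draws mulr_natl; congr ((_ *+ _)%:E).
by apply: eq_card => S; rewrite inE.
Qed.

Theorem mainTheorem6 (R : realType) (disp : measure_display)
    (Omega : measurableType disp) (P : probability Omega R)
    (N k_trap d_mal : nat)
    (hN : (1 <= N)%N) (hk : (0 <= k_trap <= N)%N) (hd : (1 <= d_mal <= N)%N)
    (traps : Omega -> {set 'I_N})
    (htraps : uniform_random_subset P k_trap traps)
    (affected : {set 'I_N}) (haffected : #|affected| = d_mal) :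
  (P (avoids_traps traps affected)
     <= ((1 - k_trap%:R / N%:R) ^+ d_mal)%:E)%E /\
  (1 - k_trap%:R / N%:R) ^+ d_mal
     <= expR (- ((d_mal%:R * k_trap%:R) / N%:R)) :> R.
Proof.
have N0 : (0 : R) < N%:R by rewrite ltr0n.
have /andP[_ lekN] := hk; have /andP[_ ledN] := hd.
have kNE : 1 - k_trap%:R / N%:R = (N - k_trap)%:R / N%:R :> R.
  by rewrite natrB // mulrBl divff // gt_eqF.
split.
  rewrite (probability_avoids_traps _ htraps) haffected lee_fin kNE expr_div_n.
  rewrite ler_pdivrMr ?ltr0n ?bin_gt0 // mulrAC ler_pdivlMr ?exprn_gt0 //.
  by rewrite -!natrX -!natrM ler_nat [leqRHS]mulnC bin_avoid_leq.
rewrite -mulrA -[X in expR X]mulrN expRM_natl.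
(* Monotonicity of the power needs a nonnegative base, which [kNE] makes visible. *)
by rewrite lerXn2r ?nnegrE ?expR_ge0 ?expR_ge1Dx // kNE divr_ge0.
Qed.
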